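(* Let $G$ be a group and $L,N$ normal subgroups with $L\geqslant N$. Assume $\mathcal{W}(G,L,N)$ is nonzero and finite dimensional, $\ell=\dim_{\mathbb{R}}\mathcal{W}(G,L,N)$. Take any basis of $\mathcal{W}(G,L,N)$ and representatives $\nu_1,\dots,\nu_\ell\in\mathrm{Q}(N)^G$, and let $Z=[G,N]\cap\bigcap_{j=1}^\ell\nu_j^{-1}(\{0\})$. Then there is a constant $C>0$ (depending on $\nu_1,\dots,\nu_\ell$) such that $\mathrm{scl}_{G,N}(z)\le C\cdot\mathrm{scl}_{G,L}(z)$ for every $z\in Z$; one may take $C=\mathscr{C}_1$, where $\mathscr{C}_1$ is any constant for which there is $\mathscr{C}_2>0$ such that every $\nu\in\mathrm{Q}(N)^G$ can be written as $\nu=k+\psi|_N+\sum_j a_j\nu_j$ with $k\in\mathrm{H}^1(N)^G$, $\psi\in\mathrm{Q}(L)^G$, $a_j\in\mathbb{R}$ and $\mathscr{D}(\nu)\ge\mathscr{C}_1^{-1}(\mathscr{D}(\psi)+\mathscr{C}_2^{-1}\sum_j|a_j|)$.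
   Context: $[G,N]$ is generated by $[g,x]=gxg^{-1}x^{-1}$ ($g\in G,x\in N$); $\mathrm{cl}_{G,N}$ word length w.r.t. these; $\mathrm{scl}_{G,N}(y)=\lim_n\mathrm{cl}_{G,N}(y^n)/n$, and similarly $\mathrm{scl}_{G,L}$. $\mathscr{D}$ is the defect $\sup|\psi(h_1h_2)-\psi(h_1)-\psi(h_2)|$. $\mathrm{Q}(N)^G$ (resp. $\mathrm{Q}(L)^G$): homogeneous quasimorphisms on $N$ (resp. $L$) invariant under $G$-conjugation; $\mathrm{H}^1(N)^G$: $G$-invariant homomorphisms $N\to\mathbb{R}$; $\mathcal{W}(G,L,N)=\mathrm{Q}(N)^G/(\mathrm{H}^1(N)^G+\{\psi|_N:\psi\in\mathrm{Q}(L)^G\})$. (Constants $\mathscr{C}_1,\mathscr{C}_2$ as described exist for any such choice of representatives.) *)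

(* Defs.v *)
From Stdlib Require Import Reals List.
From Coquelicot Require Import Coquelicot.
Open Scope R_scope.

Record Grp := {
  car :> Type;
  gmul : car -> car -> car;
  ginv : car -> car;
  gone : car;
  gmulA : forall x y z, gmul x (gmul y z) = gmul (gmul x y) z;
  gmul1l : forall x, gmul gone x = x;
  gmulVl : forall x, gmul (ginv x) x = gone
}.

Arguments gmul {_} _ _.
Arguments ginv {_} _.
Arguments gone {_}.

Fixpoint gpow {G : Grp} (x : G) (n : nat) : G :=
  match n with O => gone | S n => gmul x (gpow x n) end.

Definition normal_subgroup (G : Grp) (H : G -> Prop) : Prop :=
  H gone /\
  (forall x y, H x -> H y -> H (gmul x y)) /\
  (forall x, H x -> H (ginv x)) /\
  (forall g x, H x -> H (gmul (gmul g x) (ginv g))).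

Definition comm {G : Grp} (g x : G) : G :=
  gmul (gmul (gmul g x) (ginv g)) (ginv x).

Definition prod_comm {G : Grp} (ws : list (G * G)%type) : G :=
  fold_right (fun p acc => gmul (comm (fst p) (snd p)) acc) gone ws.

Definition cl_le (G : Grp) (H : G -> Prop) (y : G) (n : nat) : Prop :=
  exists ws : list (G * G)%type,
    List.length ws = n /\ List.Forall (fun p => H (snd p)) ws /\ y = prod_comm ws.

Definition in_comm (G : Grp) (H : G -> Prop) (y : G) : Prop :=
  exists n, cl_le G H y n.

(* cl_{G,H}(y) : minimal word length (+oo if y is not in [G,H]). *)
Definition cl (G : Grp) (H : G -> Prop) (y : G) : Rbar :=
  Glb_Rbar (fun r => exists n : nat, r = INR n /\ cl_le G H y n).

Definition scl (G : Grp) (H : G -> Prop) (y : G) : Rbar :=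
  Lim_seq (fun n => real (cl G H (gpow y n)) / INR n).

Definition defect (G : Grp) (H : G -> Prop) (psi : G -> R) : R :=
  real (Lub_Rbar (fun r => exists x y, H x /\ H y /\
          r = Rabs (psi (gmul x y) - psi x - psi y))).

Definition quasimorphism (G : Grp) (H : G -> Prop) (psi : G -> R) : Prop :=
  exists D, forall x y, H x -> H y ->
    Rabs (psi (gmul x y) - psi x - psi y) <= D.

(* Homogeneity: psi(x^n) = n psi(x) for all integers n. *)
Definition homogeneous (G : Grp) (H : G -> Prop) (psi : G -> R) : Prop :=
  forall x, H x ->
    (forall n : nat, psi (gpow x n) = INR n * psi x) /\ psi (ginv x) = - psi x.

Definition G_invariant (G : Grp) (H : G -> Prop) (psi : G -> R) : Prop :=
  forall g x, H x -> psi (gmul (gmul g x) (ginv g)) = psi x.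

Definition QG (G : Grp) (H : G -> Prop) (psi : G -> R) : Prop :=
  quasimorphism G H psi /\ homogeneous G H psi /\ G_invariant G H psi.

Definition H1G (G : Grp) (H : G -> Prop) (k : G -> R) : Prop :=
  (forall x y, H x -> H y -> k (gmul x y) = k x + k y) /\ G_invariant G H k.

Fixpoint rsum (n : nat) (f : nat -> R) : R :=
  match n with O => 0 | S n => rsum n f + f n end.

Definition in_denominator (G : Grp) (L N : G -> Prop) (f : G -> R) : Prop :=
  exists k psi, H1G G N k /\ QG G L psi /\
    forall x, N x -> f x = k x + psi x.

Definition W_basis_reps (G : Grp) (L N : G -> Prop) (ell : nat)
    (nu : nat -> G -> R) : Prop :=
  (forall j, (j < ell)%nat -> QG G N (nu j)) /\
  (forall a : nat -> R,
     in_denominator G L N (fun x => rsum ell (fun j => a j * nu j x)) ->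
     forall j, (j < ell)%nat -> a j = 0) /\
  (forall f, QG G N f ->
     exists a : nat -> R,
       in_denominator G L N (fun x => f x - rsum ell (fun j => a j * nu j x))).

Definition in_Z (G : Grp) (N : G -> Prop) (ell : nat) (nu : nat -> G -> R)
    (z : G) : Prop :=
  in_comm G N z /\ forall j, (j < ell)%nat -> nu j z = 0.

(* Main.v *)
(* By a mixed Bavard duality, scl_{G,N}(z) is attained by some f in Q(N)^G with
   defect at most 1/2.  On Z such an f agrees with its component psi in Q(L)^G,
   and |psi(z)| <= 2 D(psi) scl_{G,L}(z); hence any bound D(psi) <= C1 D(f) gives
   the constant C1.

   Duality is a Hahn-Banach argument on chains x_1 + ... + x_k of elements of N
   for the gauge lim_n cl_{G,N}(x_1^n ... x_k^n) / n.  A functional dominated by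
   this gauge is automatically homogeneous and G-invariant, and its defect is at
   most 1/2 because x^(2n) y^(2n) (x^-1 y^-1)^(2n) is a product of n commutators.

   That some constant exists is a uniform boundedness principle.  If none did, a
   gliding hump sum of 3^-i f_i, with f_i extremal for a point z_i of Z at which
   scl_{G,N} / scl_{G,L} is very large, would yield an element of Q(N)^G that is
   not controlled by scl_{G,L} on Z, although on Z it must agree with some psi in
   Q(L)^G. *)
Require Import Defs.
From Stdlib Require Import Reals Lra Lia Wf_nat.
From Stdlib Require Import Classical ClassicalEpsilon.
From Coquelicot Require Import Coquelicot.
From Stdlib Require Import List Permutation.
From mathcomp Require boolp classical_sets.
Import ListNotations.
Open Scope R_scope.

(** * Additive functionals on chains *)

Section Chains.
Context {X : Type}.

Definition lsum (f : X -> R) (l : list X) : R :=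
  fold_right (fun x s => f x + s) 0 l.

Definition lmul (n : nat) (l : list X) : list X := concat (repeat l n).

Lemma lsum_app f l l' : lsum f (l ++ l') = lsum f l + lsum f l'.
Proof. induction l as [|x l IH]; simpl; lra. Qed.

Lemma lsum_repeat f x n : lsum f (repeat x n) = INR n * f x.
Proof.
  induction n as [|n IH]; [simpl; ring|].
  rewrite S_INR; simpl repeat; simpl lsum; rewrite IH; ring.
Qed.

Lemma lsum_lmul f n l : lsum f (lmul n l) = INR n * lsum f l.
Proof.
  induction n as [|n IH]; [simpl; ring|].
  rewrite S_INR; unfold lmul in *; simpl; rewrite lsum_app, IH; ring.
Qed.

Lemma lsum_flat_map f g l :
  lsum f (flat_map g l) = lsum (fun x => lsum f (g x)) l.
Proof. induction l as [|x l IH]; simpl; rewrite ?lsum_app; lra. Qed.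

Lemma lsum_scale f c l : lsum (fun x => c * f x) l = c * lsum f l.
Proof. induction l as [|x l IH]; simpl; lra. Qed.

Lemma lsum_map f (g : X -> X) l : lsum f (map g l) = lsum (fun x => f (g x)) l.
Proof. induction l as [|x l IH]; simpl; lra. Qed.

Lemma lsum_ext (D : X -> Prop) (f g : X -> R) l :
  (forall x, D x -> f x = g x) -> Forall D l -> lsum f l = lsum g l.
Proof. intros e H; induction H as [|x l Dx _ IH]; simpl; rewrite ?e; auto; lra. Qed.

Lemma lsum_permutation f l l' : Permutation l l' -> lsum f l = lsum f l'.
Proof. induction 1; simpl; lra. Qed.

(** Indicator functions of single points read off multiplicities. Permutation goals thus become
    linear identities in [lsum], which [chain_perm] settles with [ring]. *)
Lemma permutation_of_lsum (l : list X) :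
  forall l', (forall f, lsum f l = lsum f l') -> Permutation l l'.
Proof.
  assert (pos : forall x l, 0 <= lsum (fun y : X =>
     if excluded_middle_informative (y = x) then 1 else 0) l).
  { intros x m; induction m as [|y m IH]; simpl; [lra|];
      destruct excluded_middle_informative; lra. }
  assert (mem : forall x l, 0 < lsum (fun y : X =>
     if excluded_middle_informative (y = x) then 1 else 0) l -> In x l).
  { intros x m; induction m as [|y m IH]; simpl; [lra|].
    destruct excluded_middle_informative as [e|ne]; [auto|].
    intros h; right; apply IH; lra. }
  induction l as [|x l IH]; intros l' e.
  - destruct l' as [|y l']; [constructor|].
    specialize (e (fun _ => 1)); simpl in e.
    assert (0 <= lsum (fun _ : X => 1) l') by (clear; induction l'; simpl; lra).
    lra.
  - assert (i : In x l').
    { apply mem; rewrite <- e; simpl; specialize (pos x l).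
      destruct excluded_middle_informative as [e'|ne]; [lra|easy]. }
    destruct (in_split _ _ i) as [l1 [l2 ->]].
    apply Permutation_cons_app, IH; intros f; specialize (e f).
    rewrite lsum_app in *; simpl in e; lra.
Qed.

End Chains.

Ltac chain_perm :=
  apply permutation_of_lsum; let f := fresh in intro f;
  repeat (rewrite ?lsum_app, ?lsum_repeat, ?lsum_lmul; simpl lsum);
  repeat rewrite ?plus_INR, ?mult_INR, ?S_INR; try ring.

(** * Hahn-Banach extension for constraints on chains *)

(* [P l r] reads as the constraint [lsum f l <= r] on an unknown functional [f]
   that is odd with respect to [inv]; only chains in [D] are constrained. *)
Record admissible {X : Type} (inv : X -> X) (D : X -> Prop)
    (P : list X -> R -> Prop) : Prop := {
  adm_dom : forall l r, P l r -> Forall D l;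
  adm_nil : P [] 0;
  adm_add : forall l r l' r', P l r -> P l' r' -> P (l ++ l') (r + r');
  adm_perm : forall l l' r, Permutation l l' -> P l r -> P l' r;
  adm_div : forall n l r, P (lmul (S n) l) r -> P l (r / INR (S n));
  adm_pair : forall x, D x -> P [x; inv x] 0;
  adm_cancel : forall x l r, P (x :: inv x :: l) r -> P l r;
  adm_opp : forall l r, P l r -> exists r', P (map inv l) r';
  adm_cons : forall r, P [] r -> 0 <= r
}.

Section HahnBanach.
Context {X : Type} (inv : X -> X) (D : X -> Prop).
Hypothesis invK : forall x, D x -> inv (inv x) = x.
Hypothesis invD : forall x, D x -> D (inv x).

Implicit Types (P Q : list X -> R -> Prop).
Notation adm := (admissible inv D).

Lemma adm_lmul P n l r : adm P -> P l r -> P (lmul n l) (INR n * r).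
Proof.
  intros aP H; induction n as [|n IH].
  - simpl; rewrite Rmult_0_l; apply (adm_nil _ _ _ aP).
  - rewrite S_INR; replace ((INR n + 1) * r) with (r + INR n * r) by ring.
    now apply (adm_add _ _ _ aP).
Qed.

Lemma adm_cancel_repeat P n x l r : adm P ->
  P (repeat x n ++ repeat (inv x) n ++ l) r -> P l r.
Proof.
  intros aP; induction n as [|n IH]; [easy|]; intros H; apply IH.
  apply (adm_cancel _ _ _ aP x).
  revert H; apply (adm_perm _ _ _ aP); chain_perm.
Qed.

Lemma adm_cancel_map P l r : adm P -> P (l ++ map inv l) r -> P [] r.
Proof.
  intros aP; induction l as [|x l IH]; intros H; [exact H|].
  apply IH, (adm_cancel _ _ _ aP x); revert H.
  apply (adm_perm _ _ _ aP); chain_perm.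
Qed.

Lemma adm_repeat_ge P x t n r : adm P -> (forall q, P [x] q -> t <= q) ->
  P (repeat x n) r -> INR n * t <= r.
Proof.
  intros aP h; destruct n as [|n]; intros H.
  - simpl in *; rewrite Rmult_0_l; now apply (adm_cons _ _ _ aP).
  - assert (p : P [x] (r / INR (S n))).
    { apply (adm_div _ _ _ aP); revert H; apply (adm_perm _ _ _ aP).
      chain_perm. }
    apply h in p; assert (0 < INR (S n)) by (apply lt_0_INR; lia).
    replace r with (INR (S n) * (r / INR (S n))) by (field; lra).
    apply Rmult_le_compat_l; lra.
Qed.

(* The constraints implied by those of [P] together with [f x = t]. *)
Definition fix_value P (x : X) (t : R) (l : list X) (r : R) : Prop :=
  exists n a b, P (lmul (S n) l ++ repeat x a ++ repeat (inv x) b)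
                  (INR (S n) * r + (INR a - INR b) * t).

Lemma fix_value_incl P x t l r : P l r -> fix_value P x t l r.
Proof.
  intros H; exists 0%nat, 0%nat, 0%nat; unfold lmul; simpl; rewrite !app_nil_r.
  now replace (1 * r + (0 - 0) * t) with r by ring.
Qed.

Lemma fix_value_le P x t : adm P -> D x -> fix_value P x t [x] t.
Proof.
  intros aP Dx; exists 0%nat, 0%nat, 1%nat; simpl.
  replace (1 * t + (0 - 1) * t) with 0 by ring; now apply (adm_pair _ _ _ aP).
Qed.

Lemma fix_value_ge P x t : adm P -> D x -> fix_value P x t [inv x] (- t).
Proof.
  intros aP Dx; exists 0%nat, 1%nat, 0%nat; simpl.
  replace (1 * - t + (1 - 0) * t) with 0 by ring.
  eapply (adm_perm _ _ _ aP); [apply perm_swap|]; now apply (adm_pair _ _ _ aP).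
Qed.

(** Cancelling the common part of the [a] copies of [x] and the [b] copies of [inv x] leaves
    multiples of only one of them, where the bounds on [t] apply. *)
Lemma fix_value_cons P x t r : adm P -> D x ->
  (forall q, P [x] q -> t <= q) -> (forall q, P [inv x] q -> - t <= q) ->
  fix_value P x t [] r -> 0 <= r.
Proof.
  intros aP Dx h1 h2 (n & a & b & H).
  assert (pos : 0 < INR (S n)) by (apply lt_0_INR; lia).
  assert (e : lmul (S n) ([] : list X) = []).
  { clear; induction n as [|n IH]; [reflexivity|]; exact IH. }
  rewrite e in H; simpl app in H.
  set (q := INR (S n) * r + (INR a - INR b) * t) in *.
  enough ((INR a - INR b) * t <= q).
  { unfold q in *; apply Rmult_le_reg_l with (1 := pos); lra. }
  destruct (Nat.le_ge_cases a b) as [ab|ab].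
  - assert (K : P (repeat (inv x) (b - a)) q).
    { apply (adm_cancel_repeat P a x); [easy|]; revert H.
      replace b with (a + (b - a))%nat at 1 by lia.
      apply (adm_perm _ _ _ aP); chain_perm. }
    apply (adm_repeat_ge P _ (- t)) in K; auto.
    rewrite minus_INR in K by lia; lra.
  - assert (K : P (repeat x (a - b)) q).
    { apply (adm_cancel_repeat P b x); [easy|]; revert H.
      replace a with (b + (a - b))%nat at 1 by lia.
      apply (adm_perm _ _ _ aP); chain_perm. }
    apply (adm_repeat_ge P _ t) in K; auto.
    rewrite minus_INR in K by lia; lra.
Qed.

Lemma fix_value_admissible P x t : adm P -> D x ->
  (forall q, P [x] q -> t <= q) -> (forall q, P [inv x] q -> - t <= q) ->
  adm (fix_value P x t).
Proof.
  intros aP Dx h1 h2.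
  assert (SM : forall n m, exists k, S k = (S n * S m)%nat)
    by (intros n m; exists (m + n * S m)%nat; reflexivity).
  constructor.
  - intros l r (n & a & b & H); apply (adm_dom _ _ _ aP) in H.
    unfold lmul in H; simpl in H; rewrite <- app_assoc in H.
    now apply Forall_app in H.
  - apply fix_value_incl, (adm_nil _ _ _ aP).
  (* Both constraints are brought to the common denominator [S n * S n']; the copies of [x] and
     [inv x] scale along. *)
  - intros l r l' r' (n & a & b & H) (n' & a' & b' & H').
    destruct (SM n n') as [k Hk].
    exists k, (S n' * a + S n * a')%nat, (S n' * b + S n * b')%nat.
    apply (adm_lmul P (S n')) in H; [|easy].
    apply (adm_lmul P (S n)) in H'; [|easy].
    pose proof (adm_add _ _ _ aP _ _ _ _ H H') as K; rewrite Hk.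
    match type of K with P ?l ?r => match goal with |- P _ ?s =>
      replace s with r by (repeat rewrite ?plus_INR, ?mult_INR; ring) end end.
    revert K; apply (adm_perm _ _ _ aP); chain_perm.
  - intros l l' r p (n & a & b & H); exists n, a, b; revert H.
    apply (adm_perm _ _ _ aP); chain_perm.
    now rewrite (lsum_permutation _ _ _ p).
  - intros k l r (n & a & b & H); destruct (SM n k) as [j Hj].
    exists j, a, b; rewrite Hj, mult_INR.
    assert (0 < INR (S k)) by (apply lt_0_INR; lia).
    replace (INR (S n) * INR (S k) * (r / INR (S k))) with (INR (S n) * r)
      by (field; lra).
    revert H; apply (adm_perm _ _ _ aP); chain_perm.
  - intros y Dy; now apply fix_value_incl, (adm_pair _ _ _ aP).
  - intros y l r (n & a & b & H); exists n, a, b.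
    apply (adm_cancel_repeat P (S n) y); [easy|]; revert H.
    apply (adm_perm _ _ _ aP); chain_perm.
  - intros l r (n & a & b & H); destruct (adm_opp _ _ _ aP _ _ H) as [q K].
    assert (0 < INR (S n)) by (apply lt_0_INR; lia).
    exists ((q - (INR b - INR a) * t) / INR (S n)), n, b, a.
    replace (INR (S n) * ((q - (INR b - INR a) * t) / INR (S n)) +
       (INR b - INR a) * t) with q by (field; lra).
    revert K; apply (adm_perm _ _ _ aP); apply permutation_of_lsum; intros f.
    rewrite lsum_map.
    repeat rewrite ?lsum_app, ?lsum_repeat, ?lsum_lmul.
    rewrite (invK x Dx), lsum_map; ring.
  - intros r; now apply fix_value_cons.
Qed.

(** By cancellation, upper bounds for [x] and for [inv x] have a nonnegative sum, so the interval of
    possible values is nonempty; its left end is taken. *)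
Lemma exists_admissible_value P x : adm P -> D x ->
  exists t, (forall q, P [x] q -> t <= q) /\ (forall q, P [inv x] q -> - t <= q).
Proof.
  intros aP Dx.
  assert (sum : forall q q', P [x] q -> P [inv x] q' -> - q' <= q).
  { intros q q' H H'; pose proof (adm_add _ _ _ aP _ _ _ _ H H') as K.
    apply (adm_cancel _ _ _ aP), (adm_cons _ _ _ aP) in K; lra. }
  destruct (classic (exists q, P [inv x] q)) as [[q' H']|no].
  - destruct (adm_opp _ _ _ aP _ _ H') as [q H]; simpl in H.
    rewrite invK in H by easy.
    destruct (completeness (fun s => exists q, P [inv x] q /\ s = - q))
      as [t [ub lub]].
    + exists q; intros s (p & Hp & ->); now apply sum.
    + now exists (- q'), q'.
    + exists t; split.
      * intros p Hp; apply lub; intros s (p' & Hp' & ->); now apply sum.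
      * intros p Hp; assert (- p <= t) by (apply ub; now exists p); lra.
  - exists 0; split.
    + intros q H; destruct no; exact (adm_opp _ _ _ aP _ _ H).
    + intros q H; destruct no; now exists q.
Qed.

(** This is the upper bound of a chain in Zorn's lemma. Comparability serves [adm_add], whose two
    constraints must lie in one common member. *)
Lemma admissible_union (P0 : list X -> R -> Prop) (F : (list X -> R -> Prop) -> Prop) :
  (forall P, F P -> adm P) -> F P0 ->
  (forall P Q, F P -> F Q ->
     (forall l r, P l r -> Q l r) \/ (forall l r, Q l r -> P l r)) ->
  adm (fun l r => exists P, F P /\ P l r).
Proof.
  intros aF F0 tot; pose proof (aF _ F0) as a0; constructor.
  - intros l r (P & FP & H); exact (adm_dom _ _ _ (aF _ FP) _ _ H).
  - exists P0; split; [easy|apply (adm_nil _ _ _ a0)].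
  - intros l r l' r' (P & FP & H) (Q & FQ & H').
    destruct (tot P Q FP FQ) as [h|h].
    + exists Q; split; [easy|]; apply (adm_add _ _ _ (aF _ FQ)); auto.
    + exists P; split; [easy|]; apply (adm_add _ _ _ (aF _ FP)); auto.
  - intros l l' r p (P & FP & H); exists P; split; [easy|].
    exact (adm_perm _ _ _ (aF _ FP) _ _ _ p H).
  - intros n l r (P & FP & H); exists P; split; [easy|].
    exact (adm_div _ _ _ (aF _ FP) _ _ _ H).
  - intros x Dx; exists P0; split; [easy|]; now apply (adm_pair _ _ _ a0).
  - intros x l r (P & FP & H); exists P; split; [easy|].
    exact (adm_cancel _ _ _ (aF _ FP) _ _ _ H).
  - intros l r (P & FP & H).
    destruct (adm_opp _ _ _ (aF _ FP) _ _ H) as [r' H']; now exists r', P.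
  - intros r (P & FP & H); exact (adm_cons _ _ _ (aF _ FP) _ H).
Qed.

Lemma exists_maximal_admissible P : adm P ->
  exists Q, adm Q /\ (forall l r, P l r -> Q l r) /\
    forall Q', adm Q' -> (forall l r, Q l r -> Q' l r) ->
      forall l r, Q' l r -> Q l r.
Proof.
  intros aP.
  set (ext := fun Q => adm Q /\ forall l r, P l r -> Q l r); set (T := sig ext).
  set (t0 := exist ext P (conj aP (fun l r h => h)) : T).
  destruct (@classical_sets.ZL_preorder T t0
    (fun a b : T => boolp.asbool (forall l r, proj1_sig a l r -> proj1_sig b l r)))
    as [[Q [aQ PQ]] max].
  - intros t; now apply boolp.asboolT.
  - intros a b c ab bc; apply boolp.asboolT; apply boolp.asboolW in ab, bc; auto.
  - intros A tot.
    (* The union over an empty family lacks [adm_nil], so the empty chain is bounded by [t0]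
       instead. *)
    destruct (classic (exists a, A a)) as [[a0 A0]|no];
      [|exists t0; intros s As; destruct no; now exists s].
    set (F := fun Q => exists a : T, A a /\ proj1_sig a = Q).
    assert (aU : adm (fun l r => exists Q, F Q /\ Q l r)).
    { apply (admissible_union (proj1_sig a0)).
      - intros Q (a & _ & <-); apply (proj2_sig a).
      - now exists a0.
      - intros Q Q' (a & Aa & <-) (b & Ab & <-).
        destruct (tot a b Aa Ab) as [h|h]; apply boolp.asboolW in h; auto. }
    assert (PU : forall l r, P l r -> exists Q, F Q /\ Q l r).
    { intros l r H; exists (proj1_sig a0); split; [now exists a0|].
      now apply (proj2 (proj2_sig a0)). }
    exists (exist ext _ (conj aU PU)); intros s As; apply boolp.asboolT; simpl.
    intros l r H; exists (proj1_sig s); split; [now exists s|easy].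
  - exists Q; split; [easy|]; split; [easy|]; intros Q' aQ' QQ'.
    assert (PQ' : forall l r, P l r -> Q' l r) by auto.
    specialize (max (exist ext Q' (conj aQ' PQ'))); simpl in max.
    apply boolp.asboolW, max; now apply boolp.asboolT.
Qed.

(** Maximality gives every point of [D] an exact value, since fixing an admissible one cannot add
    constraints. These values are the functional. *)
Lemma admissible_functional P : adm P ->
  exists f : X -> R, (forall l r, P l r -> lsum f l <= r) /\
    (forall x, D x -> f (inv x) = - f x).
Proof.
  intros aP; destruct (exists_maximal_admissible P aP) as (Q & aQ & PQ & max).
  assert (val : forall x, exists t, D x -> Q [x] t /\ Q [inv x] (- t)).
  { intros x; destruct (classic (D x)) as [Dx|nDx]; [|now exists 0].
    destruct (exists_admissible_value Q x aQ Dx) as (t & h1 & h2).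
    exists t; intros _.
    pose proof (max _ (fix_value_admissible Q x t aQ Dx h1 h2)
                  (fix_value_incl Q x t)) as M.
    split; apply M; [now apply fix_value_le | now apply fix_value_ge]. }
  destruct (boolp.choice val) as [f hf]; exists f.
  assert (le : forall l r, Q l r -> lsum f l <= r).
  { intros l r H.
    (* The fixed values bound the inverted chain by [- lsum f l]; added to [l] it cancels to the
       empty chain, where [adm_cons] applies. *)
    assert (K : Q (map inv l) (- lsum f l)).
    { apply (adm_dom _ _ _ aQ) in H; induction H as [|x l Dx _ IH].
      - simpl; rewrite Ropp_0; apply (adm_nil _ _ _ aQ).
      - simpl; replace (- (f x + lsum f l)) with (- f x + - lsum f l) by ring.
        apply (adm_add _ _ _ aQ [inv x]); [now apply hf | easy]. }
    enough (0 <= r + - lsum f l) by lra.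
    apply (adm_cons _ _ _ aQ), (adm_cancel_map Q l); [easy|].
    now apply (adm_add _ _ _ aQ). }
  split; [auto|]; intros x Dx; destruct (hf x Dx) as [H1 H2].
  destruct (hf (inv x) (invD x Dx)) as [H3 _].
  apply le in H2; simpl in H2.
  pose proof (adm_add _ _ _ aQ _ _ _ _ H1 H3) as K.
  apply (adm_cancel _ _ _ aQ), (adm_cons _ _ _ aQ) in K; lra.
Qed.

End HahnBanach.

(** * Mixed commutator length *)

Section Group.
Context {G : Grp}.
Implicit Types x y g : G.

Lemma gmulVr x : gmul x (ginv x) = gone.
Proof.
  rewrite <- (gmul1l G (gmul x (ginv x))), <- (gmulVl G (ginv x)), <- gmulA.
  now rewrite (gmulA G (ginv x) x), gmulVl, gmul1l.
Qed.

Lemma gmul1r x : gmul x gone = x.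
Proof. now rewrite <- (gmulVl G x), gmulA, gmulVr, gmul1l. Qed.

Lemma gmulKV x y : gmul x (gmul (ginv x) y) = y.
Proof. now rewrite gmulA, gmulVr, gmul1l. Qed.

Lemma gmulVK x y : gmul (ginv x) (gmul x y) = y.
Proof. now rewrite gmulA, gmulVl, gmul1l. Qed.

Lemma ginv_unique x y : gmul x y = gone -> y = ginv x.
Proof. intros e; now rewrite <- (gmulVK x y), e, gmul1r. Qed.

Lemma ginvK x : ginv (ginv x) = x.
Proof. symmetry; apply ginv_unique, gmulVl. Qed.

Lemma ginvM x y : ginv (gmul x y) = gmul (ginv y) (ginv x).
Proof.
  symmetry; apply ginv_unique.
  now rewrite <- gmulA, (gmulA G y), gmulVr, gmul1l, gmulVr.
Qed.

Lemma ginv1 : ginv (@gone G) = gone.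
Proof. symmetry; apply ginv_unique, gmul1l. Qed.

End Group.

Ltac grp := unfold comm;
  repeat rewrite <- ?gmulA, ?ginvM, ?ginvK, ?ginv1, ?gmul1l, ?gmul1r, ?gmulVl,
    ?gmulVr, ?gmulKV, ?gmulVK; try reflexivity.

Section Powers.
Context {G : Grp}.
Implicit Types x y g : G.

Lemma gpow_add x a b : gpow x (a + b) = gmul (gpow x a) (gpow x b).
Proof. induction a as [|a IH]; simpl; rewrite ?IH; grp. Qed.

Lemma gpow_Sr x n : gpow x (S n) = gmul (gpow x n) x.
Proof. replace (S n) with (n + 1)%nat by lia; rewrite gpow_add; simpl; grp. Qed.

Lemma gpow_mul x a b : gpow x (a * b) = gpow (gpow x a) b.
Proof.
  induction b as [|b IH]; [now rewrite Nat.mul_0_r|].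
  rewrite Nat.mul_succ_r, Nat.add_comm, gpow_add, IH; reflexivity.
Qed.

Lemma gpow_inv x n : gpow (ginv x) n = ginv (gpow x n).
Proof.
  induction n as [|n IH]; [simpl; grp|].
  rewrite gpow_Sr, IH; simpl; grp.
Qed.

Lemma gpow_conj g x n :
  gpow (gmul (gmul g x) (ginv g)) n = gmul (gmul g (gpow x n)) (ginv g).
Proof. induction n as [|n IH]; simpl; rewrite ?IH; grp. Qed.

Lemma gpow_shift x y n :
  gmul y (gpow (gmul x y) n) = gmul (gpow (gmul y x) n) y.
Proof.
  induction n as [|n IH]; [simpl; grp|].
  rewrite gpow_Sr, gmulA, IH; rewrite gpow_Sr; grp.
Qed.

End Powers.

Section CommutatorLength.
Context {G : Grp} (H : G -> Prop) (hH : normal_subgroup G H).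
Implicit Types x y g : G.
Notation cl_le := (cl_le G H).

Lemma normal_one : H gone. Proof. apply hH. Qed.
Lemma normal_mul x y : H x -> H y -> H (gmul x y). Proof. apply hH. Qed.
Lemma normal_inv x : H x -> H (ginv x). Proof. apply hH. Qed.
Lemma normal_conj g x : H x -> H (gmul (gmul g x) (ginv g)). Proof. apply hH. Qed.

Lemma normal_pow x n : H x -> H (gpow x n).
Proof.
  intros Hx; induction n; [apply normal_one | now apply normal_mul].
Qed.

Hint Resolve normal_one normal_mul normal_inv normal_conj normal_pow : core.

Lemma prod_comm_app (u v : list (G * G)) :
  prod_comm (u ++ v) = gmul (prod_comm u) (prod_comm v).
Proof.
  induction u as [|p u IH]; simpl; [now rewrite gmul1l|].
  rewrite IH; apply gmulA.
Qed.

Lemma cl_le_one : cl_le gone 0.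
Proof. now exists []. Qed.

Lemma cl_le_comm g x : H x -> cl_le (comm g x) 1.
Proof.
  intros Hx; exists [(g, x)]; split; [easy|]; split; [now repeat constructor|].
  simpl; now rewrite gmul1r.
Qed.

Lemma cl_le_mul x y n m : cl_le x n -> cl_le y m -> cl_le (gmul x y) (n + m).
Proof.
  intros (u & <- & Hu & ->) (v & <- & Hv & ->); exists (u ++ v).
  rewrite length_app, prod_comm_app; split; [easy|]; split; [|easy].
  now apply Forall_app.
Qed.

Lemma cl_le_ind (A : G -> nat -> Prop) : A gone 0%nat ->
  (forall g x y n, H x -> cl_le y n -> A y n -> A (gmul (comm g x) y) (S n)) ->
  forall y n, cl_le y n -> A y n.
Proof.
  intros A0 AS y n (ws & <- & Hws & ->).
  induction Hws as [|[g x] ws Hx Hws IH]; simpl in *; [exact A0|].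
  apply AS; [easy| |exact IH]; now exists ws.
Qed.

Lemma cl_le_normal y n : cl_le y n -> H y.
Proof.
  revert y n; apply cl_le_ind; [auto|]; intros g x y n Hx _ Hy.
  unfold comm; auto.
Qed.

Lemma cl_le_conj g y n : cl_le y n -> cl_le (gmul (gmul g y) (ginv g)) n.
Proof.
  intros Hy; revert g; revert y n Hy; apply (cl_le_ind (fun y n => forall g, _)).
  - intros g; replace (gmul _ _) with (@gone G) by grp; apply cl_le_one.
  - intros h x y n Hx _ IH g.
    replace (gmul _ _) with (gmul
      (comm (gmul (gmul g h) (ginv g)) (gmul (gmul g x) (ginv g)))
      (gmul (gmul g y) (ginv g))) by grp.
    apply (cl_le_mul _ _ 1); auto; apply cl_le_comm; auto.
Qed.

(** The inverse of [[g,x]] is written as [[g^-1, g x g^-1]], whose second entry again lies in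
    [H]. *)
Lemma cl_le_inv y n : cl_le y n -> cl_le (ginv y) n.
Proof.
  revert y n; apply cl_le_ind.
  - rewrite ginv1; apply cl_le_one.
  - intros g x y n Hx _ IH.
    replace (ginv (gmul (comm g x) y)) with (gmul (ginv y)
      (comm (ginv g) (gmul (gmul g x) (ginv g)))) by grp.
    replace (S n) with (n + 1)%nat by lia.
    apply cl_le_mul; [exact IH | apply cl_le_comm; auto].
Qed.

Lemma cl_le_pow y n k : cl_le y n -> cl_le (gpow y k) (k * n).
Proof.
  intros Hy; induction k; [apply cl_le_one | now apply cl_le_mul].
Qed.

(* Removing the handle formed by the leading [x], the first [y] and the first
   [x^-1 y^-1] from [x^(n+2) y^(n+2) (x^-1 y^-1)^(n+2)] costs one commutator and
   leaves, up to conjugation, the same word for [n] with [x] and [y] exchanged. *)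
Lemma cl_le_power_defect n : forall x y, H x -> H y ->
  cl_le (gmul (gpow x (2 * n)) (gmul (gpow y (2 * n))
          (gpow (gmul (ginv x) (ginv y)) (2 * n)))) n.
Proof.
  induction n as [|n IH]; intros x y Hx Hy.
  - simpl; rewrite !gmul1l; apply cl_le_one.
  - replace (2 * S n)%nat with (S (S (2 * n))) by lia.
    set (m := (2 * n)%nat) in *.
    set (A := gpow (gmul (ginv x) (ginv y)) (S m)).
    set (B := gpow x (S m)); set (C := gpow y (S m)).
    (* [q] is the conjugator for which the single commutator [[q^-1 x B, y q]] splits off exactly;
       [y q] lies in [H] because [x] and [y] do. *)
    set (q := gmul C B).
    assert (e : gmul (gpow x (S (S m))) (gmul (gpow y (S (S m)))
          (gpow (gmul (ginv x) (ginv y)) (S (S m)))) =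
      gmul (gmul (gmul q (comm (gmul (ginv q) (gmul x B)) (gmul y q))) (ginv q))
       (gmul (gmul y (gmul (gpow y m) (gmul (gpow x m)
          (gpow (gmul (ginv y) (ginv x)) m)))) (ginv y))).
    (* What remains is [q A], where the last [x] of [B] meets the first [x^-1] of [A]; shifting the
       [y^-1] that follows to the right end exhibits a conjugate by [y]. *)
    { transitivity (gmul (gmul (gmul q (comm (gmul (ginv q) (gmul x B))
        (gmul y q))) (ginv q)) (gmul q A)).
      - change (gmul (gmul x B) (gmul (gmul y C)
          (gmul (gmul (ginv x) (ginv y)) A)) =
          gmul (gmul (gmul q (comm (gmul (ginv q) (gmul x B)) (gmul y q)))
            (ginv q)) (gmul q A)).
        unfold q; grp.
      - f_equal; unfold q, A, B, C; rewrite (gpow_Sr x m); simpl.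
        rewrite <- !gmulA; do 3 f_equal.
        rewrite gmulKV, gpow_shift; grp. }
    rewrite e; apply (cl_le_mul _ _ 1); [|auto using cl_le_conj].
    apply cl_le_conj, cl_le_comm; unfold q, B, C; auto.
Qed.

(** * Products of powers and the stable gauge on chains *)

Definition pow_prod (n : nat) (l : list G) : G :=
  fold_right (fun x p => gmul (gpow x n) p) gone l.

Lemma pow_prod_app n l l' :
  pow_prod n (l ++ l') = gmul (pow_prod n l) (pow_prod n l').
Proof.
  induction l as [|x l IH]; simpl; rewrite ?IH, ?gmulA, ?gmul1l; reflexivity.
Qed.

Lemma pow_prod_repeat n x k : pow_prod n (repeat x k) = gpow x (n * k).
Proof.
  induction k as [|k IH]; simpl; [now rewrite Nat.mul_0_r|].
  now rewrite IH, Nat.mul_succ_r, Nat.add_comm, gpow_add.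
Qed.

(** With equal letters adjacent, [k] copies of a chain at exponent [n] become one copy at exponent
    [n * k]; this makes the gauge divisible. *)
Lemma pow_prod_flat_repeat n k l :
  pow_prod n (flat_map (fun x => repeat x k) l) = pow_prod (n * k) l.
Proof.
  induction l as [|x l IH]; simpl; [easy|].
  now rewrite pow_prod_app, pow_prod_repeat, IH.
Qed.

Lemma pow_prod_opp n l : pow_prod n (rev (map ginv l)) = ginv (pow_prod n l).
Proof.
  induction l as [|x l IH]; simpl; [now rewrite ginv1|].
  rewrite pow_prod_app, IH; simpl; rewrite gpow_inv; grp.
Qed.

(** Swapping two neighbours costs the one commutator [[x^n, y^n]], so reordering has a cost
    independent of [n], which an additive constant absorbs. *)
Lemma pow_prod_permutation l l' : Permutation l l' -> Forall H l ->
  exists K, forall n, cl_le (gmul (pow_prod n l') (ginv (pow_prod n l))) K.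
Proof.
  intros p; induction p as [|x l l' p IH|x y l|l l' l'' p IH p' IH']; intros HF.
  - exists 0%nat; intros n; simpl; rewrite gmulVr; apply cl_le_one.
  - inversion_clear HF as [|? ? Hx HF']; destruct (IH HF') as [K hK].
    exists K; intros n; simpl.
    replace (gmul _ _) with (gmul (gmul (gpow x n)
      (gmul (pow_prod n l') (ginv (pow_prod n l)))) (ginv (gpow x n))) by grp.
    now apply cl_le_conj.
  - inversion_clear HF as [|? ? Hy HF']; exists 1%nat; intros n; simpl.
    replace (gmul _ _) with (comm (gpow x n) (gpow y n)) by grp.
    apply cl_le_comm; auto.
  - destruct (IH HF) as [K hK].
    destruct IH' as [K' hK']; [now apply (Permutation_Forall p)|].
    exists (K' + K)%nat; intros n.
    replace (gmul _ _) with (gmul (gmul (pow_prod n l'') (ginv (pow_prod n l')))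
      (gmul (pow_prod n l') (ginv (pow_prod n l)))) by grp.
    now apply cl_le_mul.
Qed.

(* A lift of [scl <= r] to chains; restricting to multiples of [m] makes chains
   whose product is only torsion modulo [G,H] admissible, as [adm_div] requires. *)
Definition scl_chain_le (l : list G) (r : R) : Prop :=
  Forall H l /\ exists m C : nat, forall n, exists k,
    cl_le (pow_prod (S m * n) l) k /\ INR k <= INR (S m * n) * r + INR C.

Lemma scl_chain_le_permutation l l' r :
  Permutation l l' -> scl_chain_le l r -> scl_chain_le l' r.
Proof.
  intros p [HF (m & C & h)]; split; [now apply (Permutation_Forall p)|].
  destruct (pow_prod_permutation _ _ p HF) as [K hK].
  exists m, (K + C)%nat; intros n; destruct (h n) as (k & hk & le).
  exists (K + k)%nat; split.
  - replace (pow_prod _ l') with (gmul (gmul (pow_prod (S m * n) l')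
      (ginv (pow_prod (S m * n) l))) (pow_prod (S m * n) l)) by grp.
    now apply cl_le_mul.
  - rewrite !plus_INR; lra.
Qed.

Lemma nonneg_of_multiples r c : (forall n : nat, 0 <= INR n * r + c) -> 0 <= r.
Proof.
  intros h; apply Rnot_lt_le; intros neg.
  destruct (INR_archimed (- r) c) as [n hn]; [lra|].
  specialize (h n); nra.
Qed.

Lemma scl_chain_le_admissible : admissible ginv H scl_chain_le.
Proof.
  constructor.
  - now intros l r [HF _].
  - split; [constructor|]; exists 0%nat, 0%nat; intros n; exists 0%nat.
    split; [apply cl_le_one | simpl; lra].
  - intros l r l' r' [HF (m & C & h)] [HF' (m' & C' & h')].
    split; [now apply Forall_app|].
    (* The first witness is the predecessor of [S m * S m'], a common multiple of the two
       restrictions on exponents. *)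
    exists (m' + m * S m')%nat, (C + C')%nat; intros n.
    change (S (m' + m * S m')) with (S m * S m')%nat.
    destruct (h (S m' * n)%nat) as (k & hk & le).
    destruct (h' (S m * n)%nat) as (k' & hk' & le').
    replace (S m * (S m' * n))%nat with (S m * S m' * n)%nat in * by lia.
    replace (S m' * (S m * n))%nat with (S m * S m' * n)%nat in * by lia.
    exists (k + k')%nat; split.
    + rewrite pow_prod_app; now apply cl_le_mul.
    + rewrite (plus_INR k), (plus_INR C); lra.
  - exact scl_chain_le_permutation.
  - intros k l r h.
    apply (scl_chain_le_permutation _ (flat_map (fun x => repeat x (S k)) l)) in h.
    2:{ apply permutation_of_lsum; intros f; rewrite lsum_lmul, lsum_flat_map.
        rewrite <- lsum_scale; clear; induction l as [|x l IH]; [easy|].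
        cbn [lsum fold_right]; rewrite lsum_repeat; unfold lsum in *; lra. }
    destruct h as [HF (m & C & h)]; split.
    + clear - HF; induction l as [|x l IH]; constructor; simpl in HF.
      * now inversion HF.
      * apply IH; now apply Forall_cons_iff, proj2, Forall_app in HF.
    + exists (k + m * S k)%nat, C; intros n; destruct (h n) as (j & hj & le).
      rewrite pow_prod_flat_repeat in hj; exists j.
      change (S (k + m * S k)) with (S m * S k)%nat.
      replace (S m * S k * n)%nat with (S m * n * S k)%nat by lia.
      split; [easy|]; rewrite (mult_INR (S m * n)).
      assert (0 < INR (S k)) by (apply lt_0_INR; lia).
      replace (INR (S m * n) * INR (S k) * (r / INR (S k)))
        with (INR (S m * n) * r) by (field; lra); exact le.
  - intros x Hx; split; [repeat constructor; auto|].
    exists 0%nat, 0%nat; intros n; exists 0%nat; split; [|simpl; lra].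
    cbn [pow_prod fold_right]; rewrite gpow_inv, gmul1r, gmulVr; apply cl_le_one.
  - intros x l r [HF (m & C & h)]; split.
    + now apply Forall_cons_iff, proj2, Forall_cons_iff in HF.
    + exists m, C; intros n; destruct (h n) as (k & hk & le); exists k.
      split; [|easy]; cbn [pow_prod fold_right] in hk.
      now rewrite gpow_inv, gmulKV in hk.
  - intros l r [HF (m & C & h)]; exists r.
    (* Inversion reverses a product, so the bound is obtained for the reversed chain and then
       permuted back. *)
    apply (scl_chain_le_permutation (rev (map ginv l)));
      [symmetry; apply Permutation_rev|]; split.
    + apply Forall_rev, Forall_map; revert HF; apply Forall_impl; auto.
    + exists m, C; intros n; destruct (h n) as (k & hk & le); exists k.
      split; [|easy]; rewrite pow_prod_opp; now apply cl_le_inv.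
  - intros r [_ (m & C & h)].
    assert (0 < INR (S m)) by (apply lt_0_INR; lia).
    apply (Rmult_le_reg_l (INR (S m))); [easy|]; rewrite Rmult_0_r.
    apply (nonneg_of_multiples _ (INR C)); intros n.
    destruct (h n) as (k & _ & le); rewrite mult_INR in le.
    pose proof (pos_INR k); lra.
Qed.

End CommutatorLength.

(** * Stable length *)

Lemma fekete (a : nat -> R) : (forall n, 0 <= a n) ->
  (forall n m, a (n + m)%nat <= a n + a m) ->
  exists s : R, is_lim_seq (fun n => a n / INR n) s /\ 0 <= s /\
    forall n, INR n * s <= a n.
Proof.
  intros pos sub.
  assert (posn : forall n, 0 < INR (S n)) by (intros; apply lt_0_INR; lia).
  (* The infimum of [a n / INR n] over positive [n] is obtained as minus the supremum of the
     negatives. *)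
  destruct (completeness (fun r => exists n, r = - (a (S n) / INR (S n))))
    as [t [ub lub]].
  { exists 0; intros r [n ->].
    assert (0 <= a (S n) / INR (S n)) by (apply Rdiv_le_0_compat; auto); lra. }
  { now eexists; exists 0%nat. }
  assert (inf : forall n, INR n * - t <= a n).
  { intros [|n]; [specialize (pos 0%nat); simpl in *; lra|].
    assert (le : - (a (S n) / INR (S n)) <= t) by (apply ub; now exists n).
    replace (a (S n)) with (INR (S n) * (a (S n) / INR (S n)))
      by (field; specialize (posn n); lra).
    apply Rmult_le_compat_l; [apply Rlt_le, posn | lra]. }
  exists (- t); split; [|split; [|exact inf]].
  - apply is_lim_seq_Reals; intros eps heps.
    assert (near : exists m, a (S m) / INR (S m) < - t + eps / 2).
    { apply NNPP; intros no; assert (t <= t - eps / 2); [|lra].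
      apply lub; intros r [m ->]; apply Rnot_lt_le; intros lt.
      apply no; exists m; lra. }
    destruct near as [m hm].
    (* [M] bounds [a] at every remainder modulo [S m], uniformly in [n], so it becomes negligible
       after division by a large [n]. *)
    set (M := a 0%nat + INR (S m) * a 1%nat).
    assert (lin : forall r, a r <= a 0%nat + INR r * a 1%nat).
    { induction r as [|r IH]; [simpl; lra|].
      replace (S r) with (r + 1)%nat at 1 by lia.
      specialize (sub r 1%nat); rewrite S_INR; lra. }
    assert (mul : forall q r, a (q * S m + r)%nat <= INR q * a (S m) + a r).
    { induction q as [|q IH]; intros r; [simpl; lra|].
      replace (S q * S m + r)%nat with (S m + (q * S m + r))%nat by lia.
      specialize (sub (S m) (q * S m + r)%nat); specialize (IH r).
      rewrite S_INR; lra. }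
    assert (bnd : forall n, a n <= INR n * (a (S m) / INR (S m)) + M).
    { intros n; pose proof (Nat.div_mod_eq n (S m)) as e.
      pose proof (Nat.mod_upper_bound n (S m) ltac:(lia)) as lt.
      set (q := (n / S m)%nat) in *; set (r := (n mod S m)%nat) in *.
      rewrite Nat.mul_comm in e; specialize (mul q r); rewrite <- e in mul.
      assert (INR r <= INR (S m)) by (apply le_INR; lia).
      assert (INR q * INR (S m) <= INR n)
        by (rewrite <- mult_INR; apply le_INR; lia).
      assert (0 <= a (S m) / INR (S m)) by (apply Rdiv_le_0_compat; auto).
      assert (e' : INR q * a (S m) = INR q * INR (S m) * (a (S m) / INR (S m)))
        by (field; specialize (posn m); lra).
      specialize (lin r); specialize (pos 1%nat); unfold M; nra. }
    destruct (INR_archimed (eps / 2) M) as [n0 hn0]; [lra|].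
    exists (S n0); intros n hn.
    assert (hn' : INR n0 < INR n) by (apply lt_INR; lia).
    assert (0 < INR n) by (pose proof (pos_INR n0); lra).
    assert (lo : - t <= a n / INR n).
    { apply Rmult_le_reg_l with (INR n); [easy|]; specialize (inf n).
      replace (INR n * (a n / INR n)) with (a n) by (field; lra); exact inf. }
    assert (hi : a n / INR n < - t + eps).
    { apply Rmult_lt_reg_l with (INR n); [easy|]; specialize (bnd n).
      replace (INR n * (a n / INR n)) with (a n) by (field; lra); nra. }
    unfold Rdist; rewrite Rabs_pos_eq; lra.
  - apply Ropp_0_ge_le_contravar, Rle_ge, lub; intros r [n ->].
    assert (0 <= a (S n) / INR (S n)) by (apply Rdiv_le_0_compat; auto); lra.
Qed.

(** On [[G,H]] the infimum is a minimum over naturals, hence finite, so that [real] in the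
    definition of [scl] does not turn an infinite length into 0. *)
Lemma cl_spec {G : Grp} (H : G -> Prop) y : in_comm G H y ->
  exists n, cl G H y = INR n /\ cl_le G H y n /\
    forall k, cl_le G H y k -> (n <= k)%nat.
Proof.
  intros ex.
  destruct (dec_inh_nat_subset_has_unique_least_element (cl_le G H y)
    (fun n => classic _) ex) as (n & [hn min] & _).
  exists n; split; [|easy]; apply is_glb_Rbar_unique; split.
  - intros r (k & -> & hk); simpl; now apply le_INR, min.
  - intros b hb; apply hb; now exists n.
Qed.

Lemma in_comm_pow {G : Grp} (H : G -> Prop) (hH : normal_subgroup G H) z n :
  in_comm G H z -> in_comm G H (gpow z n).
Proof. intros [k hk]; exists (n * k)%nat; now apply cl_le_pow. Qed.

(** Concatenating words makes the length of [z^n] subadditive in [n], so Fekete's lemma applies. The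
    last two clauses say that [s] is the infimum of [k / n]. *)
Lemma scl_spec {G : Grp} (H : G -> Prop) (hH : normal_subgroup G H) z :
  in_comm G H z ->
  exists s : R, scl G H z = s /\ 0 <= s /\
    (forall n k, cl_le G H (gpow z n) k -> INR n * s <= INR k) /\
    (forall eps, 0 < eps -> exists n k, (0 < n)%nat /\
       cl_le G H (gpow z n) k /\ INR k <= INR n * (s + eps)).
Proof.
  intros hz.
  destruct (boolp.choice (fun n => cl_spec H _ (in_comm_pow H hH z n hz))) as [c hc].
  destruct (fekete (fun n => INR (c n))) as (s & lim & s0 & inf).
  - intros n; apply pos_INR.
  - intros n m; rewrite <- plus_INR; apply le_INR, hc; rewrite gpow_add.
    apply cl_le_mul; apply hc.
  - exists s; split; [|split; [easy|split]].
    + unfold scl; rewrite <- (is_lim_seq_unique _ _ lim); apply Lim_seq_ext.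
      intros n; now rewrite (proj1 (hc n)).
    + intros n k hk; eapply Rle_trans; [apply inf | now apply le_INR, hc].
    + intros eps heps; apply is_lim_seq_Reals in lim.
      destruct (lim eps heps) as [n0 hn0]; exists (S n0), (c (S n0)).
      split; [lia|]; split; [apply hc|].
      specialize (hn0 (S n0) ltac:(lia)); unfold Rdist in hn0.
      apply Rabs_def2 in hn0.
      assert (0 < INR (S n0)) by (apply lt_0_INR; lia).
      replace (INR (c (S n0))) with (INR (S n0) * (INR (c (S n0)) / INR (S n0)))
        by (field; lra).
      apply Rmult_le_compat_l; lra.
Qed.

Lemma cl_le_mono {G : Grp} (H K : G -> Prop) y n :
  (forall x, H x -> K x) -> cl_le G H y n -> cl_le G K y n.
Proof.
  intros HK (ws & e & HF & ->); exists ws; split; [easy|]; split; [|easy].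
  revert HF; apply Forall_impl; intros; now apply HK.
Qed.

(** * Invariant homogeneous quasimorphisms *)

Section Quasimorphisms.
Context {G : Grp} (H : G -> Prop) (hH : normal_subgroup G H).
Implicit Types (x y g z : G) (f : G -> R).

Local Hint Extern 1 (H _) => first
  [ apply (normal_one H hH) | apply (normal_conj H hH) | apply (normal_mul H hH)
  | apply (normal_inv H hH) | apply (normal_pow H hH) ] : core.

(** An explicit bound [D], not necessarily optimal, replaces the supremum, so that sums and limits
    are estimated without finiteness questions. *)
Definition inv_qm (D : R) f : Prop :=
  (forall x y, H x -> H y -> Rabs (f (gmul x y) - f x - f y) <= D) /\
  homogeneous G H f /\ G_invariant G H f.

Lemma inv_qm_QG D f : inv_qm D f -> QG G H f.
Proof. intros [q hi]; split; [now exists D | exact hi]. Qed.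

Lemma inv_qm_nonneg D f : inv_qm D f -> 0 <= D.
Proof.
  intros [q _]; eapply Rle_trans; [apply Rabs_pos|].
  now apply (q gone gone); apply normal_one.
Qed.

Lemma inv_qm_le D D' f : D <= D' -> inv_qm D f -> inv_qm D' f.
Proof.
  intros le [q hi]; split; [|exact hi]; intros x y Hx Hy.
  now apply Rle_trans with D; [apply q|].
Qed.

Lemma defect_le D f : inv_qm D f -> defect G H f <= D.
Proof.
  intros qf; unfold defect; set (S := fun r => _).
  destruct (Lub_Rbar_correct S) as [ub lub].
  assert (le : Rbar_le (Lub_Rbar S) D).
  { apply lub; intros r (x & y & Hx & Hy & ->); simpl; now apply qf. }
  (* The case left is [m_infty], which [real] sends to 0. *)
  destruct (Lub_Rbar S); simpl in *; try easy; now apply inv_qm_nonneg with f.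
Qed.

Lemma inv_qm_defect f : QG G H f -> inv_qm (defect G H f) f.
Proof.
  intros [[D q] hi]; split; [|exact hi].
  intros x y Hx Hy; unfold defect; set (S := fun r => _).
  destruct (Lub_Rbar_correct S) as [ub lub].
  assert (le : Rbar_le (Lub_Rbar S) D).
  { apply lub; intros r (x' & y' & Hx' & Hy' & ->); simpl; now apply q. }
  assert (ge : Rbar_le (Rabs (f (gmul x y) - f x - f y)) (Lub_Rbar S))
    by (apply ub; now exists x, y).
  now destruct (Lub_Rbar S).
Qed.

Lemma inv_qm_zero : inv_qm 0 (fun _ => 0).
Proof.
  split; [|split].
  - intros x y _ _; rewrite !Rminus_0_r, Rabs_R0; lra.
  - intros x _; split; intros; ring.
  - easy.
Qed.

Lemma inv_qm_axpy D D' c f f' : inv_qm D f -> inv_qm D' f' ->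
  inv_qm (D + Rabs c * D') (fun x => f x + c * f' x).
Proof.
  intros (q & h & i) (q' & h' & i'); split; [|split].
  - intros x y Hx Hy.
    replace (_ - _ - _) with ((f (gmul x y) - f x - f y) +
      c * (f' (gmul x y) - f' x - f' y)) by ring.
    eapply Rle_trans; [apply Rabs_triang|]; rewrite Rabs_mult.
    apply Rplus_le_compat; [now apply q|].
    apply Rmult_le_compat_l; [apply Rabs_pos | now apply q'].
  - intros x Hx; destruct (h x Hx) as [h1 h2], (h' x Hx) as [h1' h2'].
    split; intros; rewrite ?h1, ?h2, ?h1', ?h2'; ring.
  - intros g x Hx; now rewrite i, i'.
Qed.

Lemma inv_qm_odd D f x : inv_qm D f -> H x -> f (ginv x) = - f x.
Proof. intros (_ & h & _) Hx; now apply h. Qed.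

Lemma inv_qm_swap D f x y : inv_qm D f -> H x -> H y ->
  f (gmul x y) = f (gmul y x).
Proof.
  intros (_ & _ & i) Hx Hy; rewrite <- (i x (gmul y x)); auto; f_equal; grp.
Qed.

(** This is a one-sided form of the defect bound, stated as a constraint on a chain so that a
    Hahn-Banach functional can inherit it. *)
Lemma inv_qm_triple D f x y : inv_qm D f -> H x -> H y ->
  f x + f y + f (gmul (ginv x) (ginv y)) <= D.
Proof.
  intros qf Hx Hy; rewrite <- ginvM, (inv_qm_odd D) by auto.
  rewrite (inv_qm_swap D) by auto.
  pose proof (proj1 qf x y Hx Hy) as q; apply Rabs_le_between in q; lra.
Qed.

(** Passing to inverses of [x], [y] or [g] reverses each inequality, so the one-sided bounds that a
    dominated functional provides suffice. *)
Lemma inv_qm_of_inequalities D f :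
  (forall x, H x -> f (ginv x) = - f x) ->
  (forall x n, H x -> f (gpow x n) <= INR n * f x) ->
  (forall g x, H x -> f (gmul (gmul g x) (ginv g)) <= f x) ->
  (forall x y, H x -> H y -> f x + f y + f (gmul (ginv x) (ginv y)) <= D) ->
  inv_qm D f.
Proof.
  intros odd pw cj tri.
  assert (inv : G_invariant G H f).
  { intros g x Hx; apply Rle_antisym; [now apply cj|].
    eapply Rle_trans; [|apply (cj (ginv g)); auto].
    right; f_equal; grp. }
  split; [|split; [|exact inv]].
  - intros x y Hx Hy.
    assert (sw : f (gmul x y) = f (gmul y x)).
    { rewrite <- (inv x (gmul y x)); auto; f_equal; grp. }
    pose proof (tri x y Hx Hy) as t1.
    pose proof (tri (ginv x) (ginv y) ltac:(auto) ltac:(auto)) as t2.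
    rewrite !ginvK, !odd in t2 by auto.
    rewrite <- ginvM, odd, <- sw in t1 by auto.
    apply Rabs_le; lra.
  - intros x Hx; split; [|auto]; intros n; apply Rle_antisym; [auto|].
    pose proof (pw (ginv x) n ltac:(auto)) as p.
    rewrite gpow_inv, !odd in p by auto; lra.
Qed.

(** Each [[g,x]] has value at most [D] in absolute value, because those of [g x g^-1] and [x^-1]
    cancel, and each multiplication costs another [D]. *)
Lemma inv_qm_cl_le D f y n : inv_qm D f -> cl_le G H y n ->
  Rabs (f y) <= 2 * D * INR n.
Proof.
  intros qf; revert y n; pose proof qf as (q & h & i).
  apply cl_le_ind.
  - destruct (h gone) as [h1 _]; auto; specialize (h1 0%nat); simpl in h1.
    rewrite h1, Rmult_0_l, Rabs_R0; simpl; lra.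
  - intros g x y n Hx hy IH; pose proof (cl_le_normal H hH _ _ hy) as Hy.
    assert (c : Rabs (f (comm g x)) <= D).
    { pose proof (q (gmul (gmul g x) (ginv g)) (ginv x)
        ltac:(auto) ltac:(auto)) as b.
      rewrite (proj2 (h x Hx)), i in b by easy.
      replace (_ - _ - _) with (f (comm g x)) in b by (unfold comm; ring).
      exact b. }
    assert (Hc : H (comm g x)) by (unfold comm; auto).
    specialize (q _ _ Hc Hy); rewrite S_INR.
    apply Rabs_le_between in c, q, IH; apply Rabs_le; lra.
Qed.

(** The easy half of Bavard duality: the length bound is applied to [z^n] and divided by [n]. *)
Lemma inv_qm_scl_le D f z s : inv_qm D f -> in_comm G H z ->
  scl G H z = Finite s -> Rabs (f z) <= 2 * D * s.
Proof.
  intros qf hz es; pose proof (inv_qm_nonneg D f qf) as D0.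
  destruct (scl_spec H hH z hz) as (s' & es' & s0 & _ & near).
  assert (s' = s) as -> by congruence.
  apply le_epsilon; intros e he.
  (* The [+ 1] keeps the denominator positive when [D = 0]. *)
  destruct (near (e / (2 * D + 1))) as (n & k & npos & hk & le).
  { apply Rdiv_lt_0_compat; lra. }
  pose proof (inv_qm_cl_le D f _ _ qf hk) as b.
  assert (Hz : H z) by (destruct hz as [j hj]; exact (cl_le_normal H hH _ _ hj)).
  rewrite (proj1 (proj1 (proj2 qf) z Hz)), Rabs_mult in b.
  assert (0 < INR n) by now apply lt_0_INR.
  rewrite (Rabs_pos_eq (INR n)) in b by lra.
  apply Rmult_le_reg_l with (INR n); [easy|].
  apply Rle_trans with (1 := b).
  apply Rle_trans with (2 * D * (INR n * (s + e / (2 * D + 1)))).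
  { apply Rmult_le_compat_l; lra. }
  replace (2 * D * (INR n * (s + e / (2 * D + 1)))) with
    (INR n * (2 * D * s + e * (2 * D / (2 * D + 1)))) by (field; lra).
  apply Rmult_le_compat_l; [lra|].
  assert (2 * D / (2 * D + 1) <= 1).
  { apply Rmult_le_reg_r with (2 * D + 1); [lra|]; field_simplify; lra. }
  nra.
Qed.

(* The defect bound 1/2 is the cost per power in [cl_le_power_defect]. *)
Lemma bavard_duality z s : in_comm G H z -> scl G H z = Finite s ->
  exists f, inv_qm (1 / 2) f /\ f z = s.
Proof.
  intros hz es; destruct (scl_spec H hH z hz) as (s' & es' & s0 & inf & _).
  assert (s' = s) as -> by congruence.
  assert (Hz : H z) by (destruct hz as [j hj]; exact (cl_le_normal H hH _ _ hj)).
  pose proof (scl_chain_le_admissible H hH) as a0.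
  assert (invK : forall x, H x -> ginv (ginv x) = x) by (intros; apply ginvK).
  (* The value [s] at [z] is consistent: a constraint [q] on [[z]] bounds the lengths of powers of
     [z] with rate [q], so [s <= q]; on the inverse, already [0 <= q]. *)
  assert (a1 : admissible ginv H (fix_value ginv (scl_chain_le H) z s)).
  { apply fix_value_admissible; auto.
    - intros q [_ (m & C & h)].
      assert (0 < INR (S m)) by (apply lt_0_INR; lia).
      enough (0 <= INR (S m) * (q - s)) by nra.
      apply (nonneg_of_multiples _ (INR C)); intros n.
      destruct (h n) as (k & hk & le); cbn [pow_prod fold_right] in hk.
      rewrite gmul1r in hk; apply inf in hk; rewrite mult_INR in hk, le; lra.
    - intros q [_ (m & C & h)].
      assert (0 < INR (S m)) by (apply lt_0_INR; lia).
      enough (0 <= INR (S m) * q) by nra.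
      apply (nonneg_of_multiples _ (INR C)); intros n.
      destruct (h n) as (k & _ & le); pose proof (pos_INR k).
      rewrite mult_INR in *; lra. }
  destruct (admissible_functional ginv H invK ltac:(auto) _ a1)
    as (f & le & odd).
  assert (le0 : forall l r, scl_chain_le H l r -> lsum f l <= r)
    by (intros l r h; now apply le, fix_value_incl).
  exists f; split.
  - apply inv_qm_of_inequalities; [exact odd| | |].
    + intros x n Hx.
      assert (b : lsum f (gpow x n :: repeat (ginv x) n) <= 0).
      { apply le0; split.
        - constructor; auto; apply Forall_forall; intros y hy.
          apply repeat_spec in hy; subst; auto.
        - exists 0%nat, 0%nat; intros k; exists 0%nat; split; [|simpl; lra].
          cbn [pow_prod fold_right]; fold (pow_prod (1 * k) (repeat (ginv x) n)).
          rewrite pow_prod_repeat, gpow_inv, <- gpow_mul, (Nat.mul_comm n).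
          rewrite gmulVr; apply cl_le_one. }
      simpl in b; rewrite lsum_repeat, odd in b by easy; lra.
    + intros g x Hx.
      (* The [n]-th powers multiply to [[g, x^n]], one commutator for every [n], hence rate 0 with
         additive constant 1. *)
      assert (b : lsum f [gmul (gmul g x) (ginv g); ginv x] <= 0).
      { apply le0; split; [repeat constructor; auto|].
        exists 0%nat, 1%nat; intros n; exists 1%nat.
        split; [|rewrite Rmult_0_r; simpl; lra].
        cbn [pow_prod fold_right]; rewrite gpow_conj, gpow_inv, gmul1r.
        apply cl_le_comm; auto. }
      simpl in b; rewrite odd in b by easy; lra.
    + intros x y Hx Hy.
      assert (b : lsum f [x; y; gmul (ginv x) (ginv y)] <= 1 / 2).
      { apply le0; split; [repeat constructor; auto|].
        (* [m = 1] restricts to exponents [2 * n], for which [n] commutators suffice, hence the rate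
           1/2. *)
        exists 1%nat, 0%nat; intros n; exists n; split.
        - cbn [pow_prod fold_right]; rewrite gmul1r.
          now apply cl_le_power_defect.
        - rewrite mult_INR; simpl; lra. }
      simpl in b; lra.
  - pose proof (le _ _ (fix_value_le ginv H _ z s a0 Hz)) as u.
    pose proof (le _ _ (fix_value_ge ginv H _ z s a0 Hz)) as v.
    simpl in u, v; rewrite odd in v by easy; lra.
Qed.

(* The sequence need not be bounded at points outside [G,H], so a pointwise limit
   need not exist; Hahn-Banach supplies a functional compatible with its eventual
   upper bounds on the chains where it is bounded. *)
Lemma inv_qm_limit D (u : nat -> G -> R) : (forall n, inv_qm D (u n)) ->
  exists f, inv_qm D f /\ forall x M c n0, H x ->
    (forall n, Rabs (u n x) <= M) ->
    (forall n, (n0 <= n)%nat -> u n x <= c) -> f x <= c.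
Proof.
  intros qu.
  set (P := fun l r => Forall H l /\
    (exists M, forall n, Rabs (lsum (u n) l) <= M) /\
    exists n0, forall n, (n0 <= n)%nat -> lsum (u n) l <= r).
  assert (odd : forall n x, H x -> u n (ginv x) = - u n x)
    by (intros n x Hx; now apply (inv_qm_odd D)).
  assert (invK : forall x, H x -> ginv (ginv x) = x) by (intros; apply ginvK).
  assert (aP : admissible ginv H P).
  { constructor.
    - now intros l r [HF _].
    - split; [constructor|]; split.
      + exists 0; intros n; simpl; rewrite Rabs_R0; lra.
      + exists 0%nat; intros; simpl; lra.
    - intros l r l' r' (HF & [M hM] & [n0 h]) (HF' & [M' hM'] & [n0' h']).
      split; [now apply Forall_app|]; split.
      + exists (M + M'); intros n; rewrite lsum_app.
        eapply Rle_trans; [apply Rabs_triang|].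
        now apply Rplus_le_compat.
      + exists (n0 + n0')%nat; intros n hn; rewrite lsum_app.
        apply Rplus_le_compat; [apply h | apply h']; lia.
    - intros l l' r p (HF & [M hM] & [n0 h]).
      split; [now apply (Permutation_Forall p)|]; split.
      + exists M; intros n; now rewrite <- (lsum_permutation _ _ _ p).
      + exists n0; intros n hn; rewrite <- (lsum_permutation _ _ _ p); auto.
    - intros k l r (HF & [M hM] & [n0 h]).
      assert (kpos : 0 < INR (S k)) by (apply lt_0_INR; lia).
      split; [now apply Forall_app in HF|]; split.
      + exists (M / INR (S k)); intros n; specialize (hM n).
        rewrite lsum_lmul, Rabs_mult, (Rabs_pos_eq (INR _)) in hM by lra.
        apply Rmult_le_reg_l with (1 := kpos); field_simplify; lra.
      + exists n0; intros n hn; specialize (h n hn); rewrite lsum_lmul in h.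
        apply Rmult_le_reg_l with (1 := kpos); field_simplify; lra.
    - intros x Hx; split; [repeat constructor; auto|].
      assert (e : forall n, lsum (u n) [x; ginv x] = 0)
        by (intros n; simpl; rewrite odd by easy; ring).
      split; [exists 0 | exists 0%nat]; intros n; intros; rewrite e, ?Rabs_R0; lra.
    - intros x l r (HF & [M hM] & [n0 h]).
      assert (Hx : H x) by now inversion HF.
      assert (e : forall n, lsum (u n) (x :: ginv x :: l) = lsum (u n) l)
        by (intros n; simpl; rewrite odd by easy; ring).
      split; [now apply Forall_cons_iff, proj2, Forall_cons_iff in HF|].
      split; [exists M | exists n0]; intros n; intros; rewrite <- e; auto.
    - intros l r (HF & [M hM] & [n0 h]).
      assert (e : forall n, lsum (u n) (map ginv l) = - lsum (u n) l).
      { intros n; rewrite lsum_map.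
        rewrite (lsum_ext H _ (fun x => -1 * u n x));
          [|intros; rewrite odd; auto; ring|easy].
        rewrite lsum_scale; ring. }
      exists M; split; [apply Forall_map; revert HF; apply Forall_impl; auto|].
      split; [exists M | exists 0%nat]; intros n; intros; rewrite e.
      + now rewrite Rabs_Ropp.
      + specialize (hM n); apply Rabs_le_between in hM; lra.
    - intros r (_ & _ & [n0 h]); apply (h n0); lia. }
  destruct (admissible_functional ginv H invK ltac:(auto) P aP)
    as (f & le & odd').
  assert (le0 : forall l r, Forall H l ->
    (exists M, forall n, Rabs (lsum (u n) l) <= M) ->
    (forall n, lsum (u n) l <= r) -> lsum f l <= r).
  { intros l r HF hM h; apply le; split; [easy|]; split; [easy|].
    now exists 0%nat; intros n _. }
  exists f; split.
  - apply inv_qm_of_inequalities; [exact odd'| | |].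
    + intros x n Hx.
      assert (e : forall k, lsum (u k) (gpow x n :: repeat (ginv x) n) = 0).
      { intros k; simpl; rewrite lsum_repeat, odd by easy.
        rewrite (proj1 (proj1 (proj2 (qu k)) x Hx)); ring. }
      assert (b : lsum f (gpow x n :: repeat (ginv x) n) <= 0).
      { apply le0.
        - constructor; auto; apply Forall_forall; intros y hy.
          apply repeat_spec in hy; subst; auto.
        - exists 0; intros k; rewrite e, Rabs_R0; lra.
        - intros k; rewrite e; lra. }
      simpl in b; rewrite lsum_repeat, odd' in b by easy; lra.
    + intros g x Hx.
      assert (e : forall k, lsum (u k) [gmul (gmul g x) (ginv g); ginv x] = 0).
      { intros k; simpl; rewrite odd, (proj2 (proj2 (qu k))) by easy; ring. }
      assert (b : lsum f [gmul (gmul g x) (ginv g); ginv x] <= 0).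
      { apply le0; [repeat constructor; auto| |].
        - exists 0; intros k; rewrite e, Rabs_R0; lra.
        - intros k; rewrite e; lra. }
      simpl in b; rewrite odd' in b by easy; lra.
    + intros x y Hx Hy.
      assert (e : forall k, lsum (u k) [x; y; gmul (ginv x) (ginv y)] =
        u k x + u k y + u k (gmul (ginv x) (ginv y))) by (intros; simpl; ring).
      assert (b : lsum f [x; y; gmul (ginv x) (ginv y)] <= D).
      { apply le0; [repeat constructor; auto| |].
        (* The same bound at the inverses gives the lower estimate, so this chain stays bounded
           along the sequence even where single values may not. *)
        - exists D; intros k; rewrite e; apply Rabs_le; split.
          + pose proof (inv_qm_triple D _ (ginv x) (ginv y) (qu k)
              ltac:(auto) ltac:(auto)) as b.
            rewrite <- (ginvM (ginv y)), !odd in b by auto.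
            rewrite (inv_qm_swap D _ (ginv y)) in b by auto; lra.
          + now apply inv_qm_triple.
        - intros k; rewrite e; now apply inv_qm_triple. }
      simpl in b; lra.
  - intros x M c n0 Hx hM h.
    enough (lsum f [x] <= c) by (simpl in *; lra).
    apply le; split; [now repeat constructor|]; split.
    + exists M; intros n; simpl; now rewrite Rplus_0_r.
    + exists n0; intros n hn; simpl; rewrite Rplus_0_r; auto.
Qed.

End Quasimorphisms.

(** * Gliding hump *)

(* The sign of each term is chosen so that it does not cancel the value of the
   preceding partial sum at [z i]. *)
Definition hump_coef (v : R) (i : nat) : R :=
  (if Rle_dec 0 v then 1 else -1) * (1 / 3) ^ i.

Fixpoint hump {X : Type} (z : nat -> X) (f : nat -> X -> R) (n : nat) : X -> R :=
  match n with
  | O => fun _ => 0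
  | S i => fun x => hump z f i x + hump_coef (hump z f i (z i)) i * f i x
  end.

Lemma hump_coef_abs v i : Rabs (hump_coef v i) = (1 / 3) ^ i.
Proof.
  assert (0 < (1 / 3) ^ i) by (apply pow_lt; lra).
  unfold hump_coef; destruct Rle_dec; [rewrite Rabs_pos_eq | rewrite Rabs_left]; lra.
Qed.

Lemma hump_step {X : Type} (z : nat -> X) f i x p : (forall j, Rabs (f j x) <= p) ->
  Rabs (hump z f (S i) x - hump z f i x) <= (1 / 3) ^ i * p.
Proof.
  intros hp; simpl; rewrite Rplus_minus_l.
  rewrite Rabs_mult, hump_coef_abs; apply Rmult_le_compat_l; [|easy].
  apply pow_le; lra.
Qed.

(** The weights from index [a] on form a geometric series with sum [3 / 2 * (1 / 3) ^ a]. *)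
Lemma hump_tail {X : Type} (z : nat -> X) f a k x p :
  (forall j, Rabs (f j x) <= p) ->
  Rabs (hump z f (a + k) x - hump z f a x) <= 3 / 2 * (1 / 3) ^ a * p.
Proof.
  intros hp; assert (p0 : 0 <= p) by (eapply Rle_trans; [apply Rabs_pos|apply (hp 0%nat)]).
  enough (Rabs (hump z f (a + k) x - hump z f a x) <=
     3 / 2 * ((1 / 3) ^ a - (1 / 3) ^ (a + k)) * p).
  { assert (0 < (1 / 3) ^ (a + k)) by (apply pow_lt; lra); nra. }
  induction k as [|k IH].
  - rewrite Nat.add_0_r, Rminus_diag, Rabs_R0; lra.
  - rewrite Nat.add_succ_r; pose proof (hump_step z f (a + k) x p hp) as st.
    replace ((1 / 3) ^ S (a + k)) with (1 / 3 * (1 / 3) ^ (a + k)) by reflexivity.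
    apply Rabs_le_between in IH, st; apply Rabs_le; lra.
Qed.

Lemma hump_peak {X : Type} (z : nat -> X) f i : 0 <= f i (z i) ->
  (1 / 3) ^ i * f i (z i) <= hump z f (S i) (z i) \/
  hump z f (S i) (z i) <= - ((1 / 3) ^ i * f i (z i)).
Proof.
  intros p0; assert (0 < (1 / 3) ^ i) by (apply pow_lt; lra).
  simpl; unfold hump_coef; destruct Rle_dec; [left | right]; nra.
Qed.

(** At [z i] the tail after the [i]-th term is at most half of that term, by the ratio 1/3 and
    because no [f j] exceeds [f i (z i)] there. Half of the peak thus survives in the limit. *)
Lemma gliding_hump {G : Grp} (H : G -> Prop) (hH : normal_subgroup G H)
  (z : nat -> G) (f : nat -> G -> R) :
  (forall i, H (z i)) -> (forall i, inv_qm H (1 / 2) (f i)) ->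
  (forall i j, Rabs (f j (z i)) <= f i (z i)) ->
  exists h, QG G H h /\
    forall i, (1 / 3) ^ i * f i (z i) <= 2 * Rabs (h (z i)).
Proof.
  intros Hz qf bnd.
  assert (qu : forall n, inv_qm H (3 / 4) (hump z f n)).
  (* The bounds [1 / 2 * (1 / 3) ^ i] of the terms have these partial sums, with limit 3/4. *)
  { intros n; apply inv_qm_le with (3 / 4 * (1 - (1 / 3) ^ n)).
    { assert (0 < (1 / 3) ^ n) by (apply pow_lt; lra); lra. }
    induction n as [|n IH].
    - simpl; rewrite Rminus_diag, Rmult_0_r; apply inv_qm_zero.
    - pose proof (inv_qm_axpy H _ _ (hump_coef (hump z f n (z n)) n) _ _ IH (qf n))
        as q; rewrite hump_coef_abs in q.
      eapply inv_qm_le; [|exact q]; simpl; lra. }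
  destruct (inv_qm_limit H hH _ _ qu) as (h & qh & lim).
  exists h; split; [now apply inv_qm_QG with (3 / 4)|]; intros i.
  set (p := f i (z i)) in *.
  assert (p0 : 0 <= p) by (eapply Rle_trans; [apply Rabs_pos|apply (bnd i i)]).
  assert (all : forall n, Rabs (hump z f n (z i)) <= 3 / 2 * p).
  { intros n; pose proof (hump_tail z f 0 n (z i) p (bnd i)) as t; simpl in t.
    rewrite Rminus_0_r in t; lra. }
  assert (tl : forall n, (S i <= n)%nat ->
    Rabs (hump z f n (z i) - hump z f (S i) (z i)) <= 1 / 2 * ((1 / 3) ^ i * p)).
  { intros n hn; replace n with (S i + (n - S i))%nat by lia.
    pose proof (hump_tail z f (S i) (n - S i) (z i) p (bnd i)) as t.
    eapply Rle_trans; [exact t|]; simpl; lra. }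
  destruct (hump_peak z f i p0) as [up|dn].
  - fold p in up.
    (* [lim] gives only upper bounds, so a positive peak is read at the inverse. *)
    assert (b : h (ginv (z i)) <= - (1 / 2 * ((1 / 3) ^ i * p))).
    { apply (lim _ (3 / 2 * p) _ (S i)); [now apply normal_inv| |];
        intros n; intros; rewrite (inv_qm_odd H _ _ _ (qu n)) by easy.
      - now rewrite Rabs_Ropp.
      - specialize (tl n ltac:(lia)); apply Rabs_le_between in tl; lra. }
    rewrite (inv_qm_odd H _ _ _ qh) in b by easy.
    pose proof (Rle_abs (h (z i))); lra.
  - fold p in dn.
    assert (b : h (z i) <= - (1 / 2 * ((1 / 3) ^ i * p))).
    { apply (lim _ (3 / 2 * p) _ (S i)); [easy|easy|].
      intros n hn; specialize (tl n hn); apply Rabs_le_between in tl; lra. }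
    pose proof (Rle_abs (- h (z i))); rewrite Rabs_Ropp in *; lra.
Qed.

(** * Comparison of stable mixed commutator lengths *)

(** [k] vanishes on each [[g,x]], since invariance cancels the values of [g x g^-1] and [x^-1]. *)
Lemma H1G_in_comm {G : Grp} (H : G -> Prop) (hH : normal_subgroup G H) k z :
  H1G G H k -> in_comm G H z -> k z = 0.
Proof.
  intros [add inv] [n hz]; revert z n hz.
  assert (k1 : k gone = 0).
  { pose proof (add gone gone (normal_one H hH) (normal_one H hH)) as e.
    rewrite gmul1l in e; lra. }
  apply (cl_le_ind H (fun z _ => k z = 0)); [exact k1|].
  intros g x y n Hx hy IH; pose proof (cl_le_normal H hH _ _ hy) as Hy.
  pose proof (normal_inv H hH x Hx) as Hx'.
  pose proof (normal_conj H hH g x Hx) as Hgx.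
  pose proof (add x (ginv x) Hx Hx') as e; rewrite gmulVr in e.
  unfold comm; rewrite add; [|now apply normal_mul|easy].
  rewrite (add _ _ Hgx Hx'), inv by easy; lra.
Qed.

Lemma rsum_zero n a : (forall j, (j < n)%nat -> a j = 0) -> rsum n a = 0.
Proof.
  induction n as [|n IH]; intros h; simpl; [easy|].
  rewrite IH, h by auto; ring.
Qed.

Section Comparison.
Context (G : Grp) (L N : G -> Prop).
Hypothesis (hL : normal_subgroup G L) (hN : normal_subgroup G N).
Hypothesis hNL : forall x, N x -> L x.
Context (ell : nat) (nu : nat -> G -> R).

(** Only [psi] survives: [k] vanishes on [[G,N]], and each [nu j] with [j < ell] vanishes on [Z]. *)
Lemma decomposition_on_Z f k psi a z : in_Z G N ell nu z -> H1G G N k ->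
  (forall x, N x -> f x = k x + psi x + rsum ell (fun j => a j * nu j x)) ->
  f z = psi z.
Proof.
  intros [hz nz] hk dec; rewrite dec.
  - rewrite (H1G_in_comm N hN k z hk hz), rsum_zero; [ring|].
    intros j hj; rewrite nz by easy; ring.
  - destruct hz as [n hn]; exact (cl_le_normal N hN _ _ hn).
Qed.

(** Collects the data at one point of [Z]. That the extremal [f] dominates every competitor at [z]
    is what the gliding hump requires. *)
Lemma in_Z_spec z : in_Z G N ell nu z ->
  exists p s f, scl G N z = Finite p /\ scl G L z = Finite s /\ 0 <= s /\
    N z /\ inv_qm N (1 / 2) f /\ f z = p /\
    (forall g, inv_qm N (1 / 2) g -> Rabs (g z) <= p) /\
    (forall psi, QG G L psi -> Rabs (psi z) <= 2 * defect G L psi * s).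
Proof.
  intros [hz _].
  assert (hz' : in_comm G L z)
    by (destruct hz as [n hn]; exists n; now apply cl_le_mono with N).
  destruct (scl_spec N hN z hz) as (p & ep & _).
  destruct (scl_spec L hL z hz') as (s & es & s0 & _).
  destruct (bavard_duality N hN z p hz ep) as (f & qf & fz).
  exists p, s, f; do 3 (split; [easy|]); split.
  { destruct hz as [n hn]; exact (cl_le_normal N hN _ _ hn). }
  do 2 (split; [easy|]); split.
  - intros g qg; pose proof (inv_qm_scl_le N hN _ g z p qg hz ep); lra.
  - intros psi qpsi; apply (inv_qm_scl_le L hL); auto using inv_qm_defect.
Qed.

Lemma scl_le_of_decomposition C1 C2 : 0 < C1 -> 0 < C2 ->
  (forall f, QG G N f ->
     exists (k psi : G -> R) (a : nat -> R),
       H1G G N k /\ QG G L psi /\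
       (forall x, N x -> f x = k x + psi x + rsum ell (fun j => a j * nu j x)) /\
       defect G N f >= / C1 * (defect G L psi + / C2 * rsum ell (fun j => Rabs (a j)))) ->
  forall z, in_Z G N ell nu z ->
    Rbar_le (scl G N z) (Rbar_mult C1 (scl G L z)).
Proof.
  intros hC1 hC2 dec z hz.
  destruct (in_Z_spec z hz) as (p & s & f & -> & -> & s0 & _ & qf & fz & _ & psib).
  destruct (dec f (inv_qm_QG N _ _ qf)) as (k & psi & a & hk & hpsi & e & ge).
  specialize (psib psi hpsi); simpl.
  rewrite (decomposition_on_Z f k psi a z hz hk e) in fz.
  (* The coefficient sum is nonnegative and is dropped. The defect bound 1/2 of [f] leaves half of
     [C1], and the factor 2 in [psib] restores it. *)
  assert (d : defect G L psi <= C1 * (1 / 2)).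
  { pose proof (defect_le N hN _ _ qf) as df.
    assert (sp : 0 <= rsum ell (fun j => Rabs (a j))).
    { clear; induction ell as [|n IH]; simpl; [lra|].
      pose proof (Rabs_pos (a n)); lra. }
    assert (0 <= / C2 * rsum ell (fun j => Rabs (a j))).
    { apply Rmult_le_pos; [|easy]; now apply Rlt_le, Rinv_0_lt_compat. }
    apply Rmult_le_reg_l with (/ C1); [now apply Rinv_0_lt_compat|].
    rewrite <- Rmult_assoc, Rinv_l, Rmult_1_l by lra.
    assert (0 < / C1) by now apply Rinv_0_lt_compat.
    nra. }
  pose proof (Rle_abs (psi z)); nra.
Qed.

Lemma exists_scl_bound : W_basis_reps G L N ell nu ->
  exists C : R, 0 < C /\ forall z, in_Z G N ell nu z ->
    Rbar_le (scl G N z) (Rbar_mult C (scl G L z)).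
Proof.
  intros (_ & _ & span).
  assert (dec : forall f, QG G N f -> exists psi, QG G L psi /\
    forall z, in_Z G N ell nu z -> f z = psi z).
  { intros f qf; destruct (span f qf) as (a & k & psi & hk & hpsi & e).
    exists psi; split; [easy|]; intros z hz.
    apply (decomposition_on_Z f k psi a); [easy|easy|].
    intros x Nx; specialize (e x Nx); simpl in e; lra. }
  apply NNPP; intros no.
  assert (bad : forall i : nat, exists w : G * (G -> R) * R,
    let z := fst (fst w) in let f := snd (fst w) in let s := snd w in
    in_Z G N ell nu z /\ N z /\ inv_qm N (1 / 2) f /\
    (forall g, inv_qm N (1 / 2) g -> Rabs (g z) <= f z) /\
    (forall psi, QG G L psi -> Rabs (psi z) <= 2 * defect G L psi * s) /\
    0 < s /\ INR (S i) * s <= (1 / 3) ^ i * f z).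
  { intros i; apply NNPP; intros none; apply no.
    assert (t0 : 0 < 3 ^ i) by (apply pow_lt; lra).
    assert (i0 : 0 < INR (S i)) by (apply lt_0_INR; lia).
    (* The power of 3 offsets the weight of the [i]-th hump; the factor [INR (S i)] makes the
       remaining ratio unbounded. *)
    exists (3 ^ i * INR (S i)); split; [nra|]; intros z hz.
    destruct (in_Z_spec z hz) as (p & s & f & ep & es & s0 & Nz & qf & fz & dom & psib).
    rewrite ep, es; cbn [Rbar_mult Rbar_mult' Rbar_le]; apply Rnot_lt_le; intros lt.
    apply none; exists (z, f, s); cbn [fst snd]; rewrite fz.
    do 5 (split; [easy|]); split.
    (* If [s = 0], the component [psi] of [f] vanishes at [z], hence so does [f], against [lt]. *)
    - apply Rnot_le_lt; intros le; assert (s = 0) as -> by lra.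
      destruct (dec f (inv_qm_QG N _ _ qf)) as (psi & qpsi & e).
      specialize (psib psi qpsi); rewrite <- e in psib by easy.
      pose proof (Rle_abs (f z)); lra.
    - apply Rmult_le_reg_l with (3 ^ i); [easy|].
      rewrite <- Rmult_assoc, <- (Rmult_assoc (3 ^ i) ((1 / 3) ^ i)), <- Rpow_mult_distr.
      replace (3 * (1 / 3)) with 1 by field; rewrite pow1; lra. }
  destruct (boolp.choice bad) as [w hw]; clear bad.
  set (z := fun i => fst (fst (w i))); set (f := fun i => snd (fst (w i))).
  set (s := fun i => snd (w i)).
  destruct (gliding_hump N hN z f) as (h & qh & big).
  - intros i; apply hw.
  - intros i; apply hw.
  - intros i j; apply hw, hw.
  - destruct (dec h qh) as (psi & qpsi & e).
    (* From [(i + 1) s <= 3^-i f_i(z_i) <= 2 |psi(z_i)| <= 4 D(psi) s] with [s > 0] follows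
       [i + 1 <= 4 D(psi)], which fails for this [i]. *)
    destruct (INR_archimed 1 (4 * defect G L psi)) as [i hi]; [lra|].
    destruct (hw i) as (hz & _ & _ & _ & psib & s0 & le).
    specialize (psib psi qpsi); specialize (big i); specialize (e _ hz).
    fold (z i) (f i) (s i) in *; rewrite e in big; rewrite S_INR in le.
    nra.
Qed.

End Comparison.

Theorem theorem11p24 (G : Grp) (L N : G -> Prop)
  (hL : normal_subgroup G L) (hN : normal_subgroup G N)
  (hNL : forall x, N x -> L x)
  (ell : nat) (nu : nat -> G -> R)
  (hell : (1 <= ell)%nat)
  (hbasis : W_basis_reps G L N ell nu) :
  (exists C : R, 0 < C /\
     forall z, in_Z G N ell nu z ->
       Rbar_le (scl G N z) (Rbar_mult C (scl G L z))) /\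
  (forall C1 C2 : R, 0 < C1 -> 0 < C2 ->
     (forall f, QG G N f ->
        exists (k psi : G -> R) (a : nat -> R),
          H1G G N k /\ QG G L psi /\
          (forall x, N x -> f x = k x + psi x + rsum ell (fun j => a j * nu j x)) /\
          defect G N f >= / C1 * (defect G L psi + / C2 * rsum ell (fun j => Rabs (a j)))) ->
     forall z, in_Z G N ell nu z ->
       Rbar_le (scl G N z) (Rbar_mult C1 (scl G L z))).
Proof.
  split.
  - now apply exists_scl_bound.
  - intros C1 C2; now apply scl_le_of_decomposition.
Qed.
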